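(* Let $\mathcal{P}_0\subset\Delta_{k-1}$ be a closed null hypothesis set with $\emptyset\neq\mathcal{P}_0\neq\Delta_{k-1}$, let $\mathcal{P}_A=\Delta_{k-1}\setminus\mathcal{P}_0$, and let $n$ be a sample size. (i) There exists an NTUB test of $\mathcal{P}_0$ against $\mathcal{P}_A$ for sample size $n$ if and only if there exists a polynomial $\tilde\beta\in\mathbb{R}[\pi_1,\dots,\pi_k]$ of degree less than or equal to $n$ that is non-constant on $\Delta_{k-1}$ and satisfies $$\mathcal{P}_0\subseteq\{\boldsymbol\pi\in\Delta_{k-1}:\tilde\beta(\boldsymbol\pi)\le 0\}\quad\text{and}\quad \mathcal{P}_A\subseteq\{\boldsymbol\pi\in\Delta_{k-1}:\tilde\beta(\boldsymbol\pi)\ge 0\}.$$ (ii) There exists an SUB test of $\mathcal{P}_0$ against $\mathcal{P}_A$ for sample size $n$ if and only if there exists a polynomial $\tilde\beta\in\mathbb{R}[\pi_1,\dots,\pi_k]$ of degree less than or equal to $n$ that is non-constant on $\Delta_{k-1}$ and satisfies $$\mathcal{P}_0=\{\boldsymbol\pi\in\Delta_{k-1}:\tilde\beta(\boldsymbol\pi)\le 0\}\quad\text{and}\quad \mathcal{P}_A=\{\boldsymbol\pi\in\Delta_{k-1}:\tilde\beta(\boldsymbol\pi)> 0\}.$$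
   Context: Fix $k\ge 2$ and let $\Delta_{k-1}=\{\boldsymbol\pi\in\mathbb{R}^k:\pi_i\ge0,\ \sum_{i=1}^k\pi_i=1\}$. The data are $\mathbf X\sim\text{Multinomial}_k(\boldsymbol\pi,n)$ with unknown $\boldsymbol\pi\in\Delta_{k-1}$, where $n$ is the sample size. A (randomized) test for sample size $n$ is a function $\phi:\{\mathbf x\in\mathbb{N}^k:\sum_i x_i=n\}\to[0,1]$ ($\mathbb{N}$ includes $0$); its power function is $\beta_\phi(\boldsymbol\pi)=E_{\boldsymbol\pi}(\phi(\mathbf X))=\sum_{\mathbf x}\phi(\mathbf x)\frac{n!}{x_1!\cdots x_k!}\prod_{i=1}^k\pi_i^{x_i}$ for $\boldsymbol\pi\in\Delta_{k-1}$. The test is unbiased for $\mathcal{P}_0$ against $\mathcal{P}_A$ if $\beta_\phi(\boldsymbol\pi_0)\le\beta_\phi(\boldsymbol\pi_A)$ for all $\boldsymbol\pi_0\in\mathcal{P}_0$, $\boldsymbol\pi_A\in\mathcal{P}_A$. It is non-trivial unbiased (NTUB) if it is unbiased and $\beta_\phi$ is not constant on $\Delta_{k-1}$. It is strictly unbiased (SUB) if $\beta_\phi(\boldsymbol\pi_0)<\beta_\phi(\boldsymbol\pi_A)$ for all $\boldsymbol\pi_0\in\mathcal{P}_0$, $\boldsymbol\pi_A\in\mathcal{P}_A$. *)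

(* Defs.v *)
(* MathComp-Analysis; the reals are an arbitrary R : realType. Importing mpoly
   after the analysis library fails, as their notations clash. *)
From mathcomp Require Import all_boot all_order all_algebra.
From mathcomp Require Import mpoly.
From mathcomp Require Import all_classical all_reals all_analysis.

Set Implicit Arguments.
Unset Strict Implicit.
Unset Printing Implicit Defensive.

Import Order.TTheory GRing.Theory Num.Theory.
Import numFieldNormedType.Exports.

Local Open Scope classical_set_scope.
Local Open Scope ring_scope.

(* Points of R^k are row vectors, so that their topology is the library's one. *)
Definition simplex (R : realType) (k : nat) : set 'rV[R]_k :=
  [set p | (forall i, 0 <= p 0 i) /\ \sum_(i < k) p 0 i = 1].
Arguments simplex R k _ : clear implicits.

(* The vectors x in N^k with x_1 + ... + x_k = n. Coordinates of such vectors
   are at most n, so taking them in 'I_n.+1 loses nothing and makes the sample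
   space a finType. *)
Definition sample (k n : nat) : finType :=
  {x : {ffun 'I_k -> 'I_n.+1} | (\sum_(i < k) x i)%N == n}.

Definition multinomial_pmf (R : realType) (k n : nat) (p : 'rV[R]_k)
    (x : sample k n) : R :=
  n`!%:R / (\prod_(i < k) (val x i)`!)%:R * \prod_(i < k) p 0 i ^+ val x i.

Record test (R : realType) (k n : nat) := Test {
  test_fun :> sample k n -> R;
  test_range : forall x, 0 <= test_fun x <= 1 }.

Definition power (R : realType) (k n : nat) (phi : test R k n)
    (p : 'rV[R]_k) : R :=
  \sum_(x : sample k n) phi x * multinomial_pmf p x.

Definition constant_on (T U : Type) (A : set T) (f : T -> U) : Prop :=
  exists c : U, forall x, A x -> f x = c.

Definition unbiased (R : realType) (k n : nat) (P0 PA : set 'rV[R]_k)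
    (phi : test R k n) : Prop :=
  forall p0 pA, P0 p0 -> PA pA -> power phi p0 <= power phi pA.

Definition NTUB (R : realType) (k n : nat) (P0 PA : set 'rV[R]_k)
    (phi : test R k n) : Prop :=
  unbiased P0 PA phi /\ ~ constant_on (simplex R k) (power phi).

Definition SUB (R : realType) (k n : nat) (P0 PA : set 'rV[R]_k)
    (phi : test R k n) : Prop :=
  forall p0 pA, P0 p0 -> PA pA -> power phi p0 < power phi pA.

Definition peval (R : realType) (k : nat) (b : {mpoly R[k]})
    (p : 'rV[R]_k) : R :=
  b.@[fun i => p 0 i].

(* msize is 1 + the total degree, and 0 for the zero polynomial. *)
Definition degree_le (R : realType) (k : nat) (b : {mpoly R[k]})
    (n : nat) : Prop :=
  (msize b <= n.+1)%N.

(* Main.v *)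
(* Power functions for sample size n are exactly the polynomials of degree at most n
   restricted to the simplex, up to a positive affine change: multiplying each monomial
   of degree d by (p_1 + ... + p_k)^(n - d) = 1 makes b homogeneous of degree n, so b is
   a linear combination of the multinomial probabilities; rescaling the coefficients of
   this combination into [0, 1] gives a test. Conversely one subtracts from the power
   function its supremum over P0, which is attained when P0 is closed. *)
Require Import Defs.
From mathcomp Require Import all_boot all_order all_algebra.
From mathcomp Require Import mpoly.
From mathcomp Require Import all_classical all_reals all_analysis.
From mathcomp Require Import ring lra.
Import Order.TTheory GRing.Theory Num.Theory.
Import numFieldNormedType.Exports.
Local Open Scope classical_set_scope.
Local Open Scope ring_scope.

(** * Multinomial coefficients by differentiation *)

Lemma mderiv_sumXn {R : comNzRingType} {k : nat} (n : nat) (i : 'I_k) :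
  ((\sum_j 'X_j) ^+ n.+1 : {mpoly R[k]})^`M(i) = (\sum_j 'X_j) ^+ n *+ n.+1.
Proof.
have dS : (\sum_j 'X_j : {mpoly R[k]})^`M(i) = 1.
  rewrite linear_sum (bigD1 i) //= mderivX mnm1E eqxx scale1r big1 ?addr0.
    by rewrite -mpolyX0; congr 'X_[_]; apply/mnmP => j; rewrite !mnmE subnn.
  by move=> j ji; rewrite mderivX mnm1E (negbTE ji) scale0r.
elim: n => [|n IHn]; first by rewrite expr1 expr0 dS.
by rewrite exprS mderivM IHn dS mul1r mulrnAr -exprS -mulrS.
Qed.

(** The factor [(m i).+1] is the one that differentiation in [X_i] puts in front of the coefficient
    of [X^(m + U_i)]. *)
Lemma prod_fact_mnmDU {k : nat} (m : 'X_{1..k}) (i : 'I_k) :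
  (\prod_j ((m + U_(i))%MM j)`! = (m i).+1 * \prod_j (m j)`!)%N.
Proof.
rewrite (bigD1 i) //= [in RHS](bigD1 i) //= mnmDE mnm1E eqxx addn1 factS mulnA.
by congr muln; apply: eq_bigr => j ji; rewrite mnmDE mnm1E eq_sym (negbTE ji) addn0.
Qed.

(* Multinomial theorem: the coefficient of X^(m + U_i) in S^(n+1)
   is read off the derivative of S^(n+1) in X_i. *)
Lemma mcoeff_sumXn {R : comNzRingType} {k n : nat} (m : 'X_{1..k}) : mdeg m = n ->
  ((\sum_j 'X_j) ^+ n : {mpoly R[k]})@_m *+ \prod_j (m j)`! = n`!%:R.
Proof.
elim: n m => [|n IHn] m.
  move/eqP; rewrite mdeg_eq0 => /eqP ->; rewrite expr0 mcoeff1 eqxx big1 //.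
  by move=> i _; rewrite mnm0E.
move=> mn; have [i mi] : exists i, (0 < m i)%N.
  apply/existsP; apply: contraPT mn; rewrite negb_exists => /forallP h.
  by rewrite mdegE big1 // => i _; apply/eqP; rewrite -leqn0 leqNgt.
have mE : (m - U_(i) + U_(i))%MM = m by apply/submK; rewrite lep1mP -lt0n.
have dm : mdeg (m - U_(i))%MM = n.
  by apply/eqP; rewrite -eqSS -mn -[in X in _ == X]mE mdegD mdeg1 addn1.
rewrite -mE prod_fact_mnmDU mulrnA -mcoeff_deriv mderiv_sumXn mcoeffMn.
by rewrite -mulrnA mulnC mulrnA IHn // factS mulnC natrM mulr_natr.
Qed.

(** * Sample points as exponent vectors of total degree [n] *)

Definition sample_mnm {k n : nat} (x : sample k n) : 'X_{1..k} :=
  [multinom nat_of_ord (val x i) | i < k].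

Lemma mdeg_sample_mnm {k n : nat} (x : sample k n) : mdeg (sample_mnm x) = n.
Proof.
by rewrite mdegE -[RHS](eqP (valP x)); apply: eq_bigr => i _; rewrite mnmE.
Qed.

Lemma sample_mnm_inj {k n : nat} : injective (@sample_mnm k n).
Proof.
move=> x y /mnmP xy; apply/val_inj/ffunP => i; apply/val_inj.
by have := xy i; rewrite !mnmE.
Qed.

Lemma sample_mnm_surj {k n : nat} (m : 'X_{1..k}) : mdeg m = n ->
  exists x : sample k n, m = sample_mnm x.
Proof.
move=> mn; have mi i : (m i < n.+1)%N.
  by rewrite ltnS -mn mdegE (bigD1 i) //= leq_addr.
pose f : {ffun 'I_k -> 'I_n.+1} := [ffun i => Ordinal (mi i)].
have fn : (\sum_i f i)%N == n.
  by apply/eqP; rewrite -[RHS]mn mdegE; apply: eq_bigr => i _; rewrite ffunE.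
exists (exist (fun f : {ffun 'I_k -> 'I_n.+1} => (\sum_i f i)%N == n) f fn).
by apply/mnmP => i; rewrite mnmE [val _]/= ffunE.
Qed.

(** Coefficients are compared: in degree [n] exactly one sample point contributes, and in any other
    degree both sides vanish. *)
Lemma homog_sum_sample {R : realType} {k n : nat} (h : {mpoly R[k]}) :
  h \is n.-homog ->
  h = \sum_(x : sample k n) h@_(sample_mnm x) *: 'X_[sample_mnm x].
Proof.
move=> hn; apply/mpolyP => m; rewrite raddf_sum /=.
under eq_bigr => x _ do rewrite mcoeffZ mcoeffX.
have [/sample_mnm_surj[x ->]|mn] := eqVneq (mdeg m) n.
  rewrite (bigD1 x) //= eqxx mulr1 big1 ?addr0 // => y yx.
  by rewrite (inj_eq sample_mnm_inj) (negbTE yx) mulr0.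
rewrite (dhomog_nemf_coeff hn mn) big1 // => x _.
have [xm|_] := eqVneq (sample_mnm x) m; last by rewrite mulr0.
by rewrite -xm mdeg_sample_mnm eqxx in mn.
Qed.

Lemma dhomog_sumXn {R : realType} {k : nat} (n : nat) :
  ((\sum_j 'X_j) ^+ n : {mpoly R[k]}) \is n.-homog.
Proof.
rewrite -[X in X.-homog]mul1n; apply: dhomogMn; apply: rpred_sum => j _.
by rewrite dhomogX; apply/eqP/mdeg1.
Qed.

(** * Multinomial probabilities as rescaled monomials *)

Definition multinomial_coef {R : realType} {k n : nat} (x : sample k n) : R :=
  n`!%:R / (\prod_(i < k) (val x i)`!)%:R.

Lemma multinomial_coef_gt0 {R : realType} {k n : nat} (x : sample k n) :
  0 < multinomial_coef x :> R.
Proof.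
by rewrite divr_gt0 // ltr0n ?fact_gt0 // prodn_gt0 // => i; rewrite fact_gt0.
Qed.

Lemma multinomial_pmfE {R : realType} {k n : nat} (p : 'rV[R]_k) (x : sample k n) :
  multinomial_pmf p x = multinomial_coef x * peval 'X_[sample_mnm x] p.
Proof.
rewrite /multinomial_pmf /peval mevalX; congr (_ * _).
by apply: eq_bigr => i _; rewrite mnmE.
Qed.

Lemma mcoeff_sumXn_sample {R : realType} {k n : nat} (x : sample k n) :
  ((\sum_j 'X_j) ^+ n : {mpoly R[k]})@_(sample_mnm x) = multinomial_coef x.
Proof.
rewrite /multinomial_coef -(mcoeff_sumXn _ (mdeg_sample_mnm x)) -[X in X / _]mulr_natr.
under [in RHS]eq_bigr => i _ do rewrite mnmE.
by rewrite mulfK // pnatr_eq0 -lt0n prodn_gt0 // => i; rewrite fact_gt0.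
Qed.

Lemma peval_sumX {R : realType} {k : nat} (p : 'rV[R]_k) :
  simplex R k p -> peval (\sum_j 'X_j) p = 1.
Proof.
by case=> _ <-; rewrite /peval raddf_sum; apply: eq_bigr => j _; rewrite /= mevalXU.
Qed.

(** An identity of polynomials, valid at every [p]. The quotients of coefficients play the role of
    the values [phi x] in a power function, except that they may leave [0, 1]. *)
Lemma peval_homog {R : realType} {k n : nat} {h : {mpoly R[k]}} (p : 'rV[R]_k) :
  h \is n.-homog -> peval h p =
  \sum_(x : sample k n) h@_(sample_mnm x) / multinomial_coef x * multinomial_pmf p x.
Proof.
move=> /homog_sum_sample {1}->; rewrite /peval raddf_sum.
apply: eq_bigr => x _ /=.
by rewrite mevalZ multinomial_pmfE mulrA divfK // gt_eqF // multinomial_coef_gt0.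
Qed.

(** This is [peval_homog] for [(X_1 + ... + X_k)^n]: its quotients of coefficients are all 1, and
    its value on the simplex is 1. *)
Lemma sum_multinomial_pmf {R : realType} {k n : nat} (p : 'rV[R]_k) :
  simplex R k p -> \sum_(x : sample k n) multinomial_pmf p x = 1.
Proof.
move=> sp; have := peval_homog p (dhomog_sumXn n).
rewrite /peval rmorphXn /= -/(peval _ _) peval_sumX // expr1n => ->.
apply: eq_bigr => x _; rewrite mcoeff_sumXn_sample divff ?mul1r //.
by rewrite gt_eqF // multinomial_coef_gt0.
Qed.

(** * Passage between polynomials and tests *)

Lemma homogenize {R : realType} {k n : nat} (b : {mpoly R[k]}) : degree_le b n ->
  exists2 h : {mpoly R[k]}, h \is n.-homog &
    forall p, simplex R k p -> peval h p = peval b p.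
Proof.
move=> bn.
exists (\sum_(m <- msupp b) b@_m *: ('X_[m] * (\sum_j 'X_j) ^+ (n - mdeg m))).
  rewrite big_seq; apply: rpred_sum => m mb; apply: rpredZ.
  (* This makes [n - mdeg m] a genuine difference, so that the degrees add up to [n]. *)
  have mn : (mdeg m <= n)%N by have := leq_trans (msize_mdeg_lt mb) bn.
  have Xm : ('X_[m] : {mpoly R[k]}) \is (mdeg m).-homog by rewrite dhomogX.
  by have := dhomogM Xm (dhomog_sumXn (n - mdeg m)); rewrite /= subnKC.
move=> p sp; rewrite /peval raddf_sum /= [in RHS](mpolyE b) raddf_sum /=.
apply: eq_bigr => m _; rewrite !mevalZ mevalM rmorphXn /=.
by rewrite -/(peval (\sum_j _) p) peval_sumX // expr1n mulr1.
Qed.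

Lemma test_of_poly {R : realType} {k n : nat} (b : {mpoly R[k]}) : degree_le b n ->
  exists (phi : test R k n) (a : R), 0 < a /\
    forall p, simplex R k p -> power phi p = 1 / 2 + a * peval b p.
Proof.
move=> /homogenize[h hn hb].
pose c (x : sample k n) : R := h@_(sample_mnm x) / multinomial_coef x.
(* A common bound for all [|c x|]; the summand 1 keeps it positive even if every [c x] is zero. *)
pose M := 1 + \sum_x `|c x|.
have M0 : 0 < M by rewrite ltr_pwDl // sumr_ge0.
have cM x : `|c x| <= M.
  by rewrite /M (bigD1 x) //= addrCA lerDl addr_ge0 // sumr_ge0.
(* With this scale [|a * c x| <= 1 / 2], so centring at 1 / 2 gives values in [0, 1]. *)
pose a := (2 * M)^-1; have a0 : 0 < a by rewrite invr_gt0 mulr_gt0.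
have phi01 x : 0 <= 1 / 2 + a * c x <= 1.
  have : `|a * c x| <= 1 / 2.
    rewrite normrM gtr0_norm // -[1 / 2](_ : a * M = _) ?ler_pM2l //.
    by rewrite /a; field; rewrite gt_eqF.
  by rewrite ler_norml => /andP[? ?]; apply/andP; split; lra.
exists (Test phi01), a; split=> // p sp.
rewrite -hb // (peval_homog p hn) /power /=.
(* The constant 1 / 2 comes out unchanged because the probabilities sum to 1. *)
under eq_bigr => x _ do rewrite mulrDl -[a * _ * _]mulrA.
by rewrite big_split /= -!mulr_sumr sum_multinomial_pmf // mulr1.
Qed.

Lemma poly_of_test {R : realType} {k n : nat} (phi : test R k n) :
  exists2 b : {mpoly R[k]}, degree_le b n & forall p, peval b p = power phi p.
Proof.
exists (\sum_x (phi x * multinomial_coef x) *: 'X_[sample_mnm x]).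
  apply: leq_trans (mmeasure_sum _ _ _ _) _; apply/bigmax_leqP => x _.
  by apply: leq_trans (msizeZ_le _ _) _; rewrite msizeX mdeg_sample_mnm.
move=> p; rewrite /peval raddf_sum; apply: eq_bigr => x _ /=.
by rewrite mevalZ multinomial_pmfE mulrA.
Qed.

Lemma degree_le_subC {R : realType} {k n : nat} (b : {mpoly R[k]}) (c : R) :
  degree_le b n -> degree_le (b - c%:MP) n.
Proof.
move=> bn; apply: leq_trans (mmeasureD_le _ _ _) _; rewrite geq_max bn mmeasureN.
by rewrite mmeasureC; case: eqP.
Qed.

Lemma peval_subC {R : realType} {k : nat} (b : {mpoly R[k]}) (c : R) (p : 'rV[R]_k) :
  peval (b - c%:MP) p = peval b p - c.
Proof. by rewrite /peval mevalB mevalC. Qed.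

(** * Continuity and compactness *)

Lemma continuous_peval {R : realType} {k : nat} (b : {mpoly R[k]}) :
  continuous (peval b).
Proof.
have contX (m : 'X_{1..k}) : continuous (fun p : 'rV[R]_k => \prod_i p 0 i ^+ m i).
  apply: (@continuous_big R _ *%R 1 xpredT (@mul_continuous R) _ _
    (fun i (p : 'rV[R]_k) => p 0 i ^+ m i)) => i _ p.
  by apply: (@continuous_comp _ _ _ (fun p : 'rV[R]_k => p 0 i) (fun x : R => x ^+ m i));
    [exact: coord_continuous|exact: exprn_continuous].
have contM (m : 'X_{1..k}) :
    continuous (fun p : 'rV[R]_k => b@_m * \prod_i p 0 i ^+ m i).
  by move=> p; apply: continuousM; [exact: cst_continuous|exact: contX].
have add_cont : continuous (fun x : R * R => x.1 + x.2) by exact: add_continuous.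
rewrite (_ : peval b = fun p => \sum_(m <- msupp b) b@_m * \prod_i p 0 i ^+ m i).
  exact: (@continuous_big R _ +%R 0 xpredT add_cont _ _ _ (fun m _ => contM m)).
by apply/funext => p; rewrite /peval mevalE.
Qed.

(** The simplex lies in the compact cube [0, 1]^k: a coordinate is at most the sum of all of them,
    which is 1. *)
Lemma closed_simplex_compact {R : realType} {k : nat} (A : set 'rV[R]_k) :
  A `<=` simplex R k -> closed A -> compact A.
Proof.
move=> As Acl; have cube_compact :=
  @rV_compact R k (fun=> `[0, 1]%classic) (fun=> @segment_compact R 0 1).
apply: (subclosed_compact Acl cube_compact).
move=> p /As[p0 p1] i /=; rewrite in_itv /= p0 -p1 (bigD1 i) //= lerDl.
exact: sumr_ge0.
Qed.

Theorem theorem1 (R : realType) (k n : nat) (k_ge2 : (2 <= k)%N)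
    (P0 PA : set 'rV[R]_k)
    (P0_sub : P0 `<=` simplex R k)
    (P0_closed : closed P0)
    (P0_neq0 : P0 <> set0)
    (P0_neqT : P0 <> simplex R k)
    (PA_def : PA = simplex R k `\` P0) :
  ((exists phi : test R k n, NTUB P0 PA phi) <->
   (exists b : {mpoly R[k]},
     [/\ degree_le b n,
         ~ constant_on (simplex R k) (peval b),
         P0 `<=` [set p | simplex R k p /\ peval b p <= 0] &
         PA `<=` [set p | simplex R k p /\ 0 <= peval b p]])) /\
  ((exists phi : test R k n, SUB P0 PA phi) <->
   (exists b : {mpoly R[k]},
     [/\ degree_le b n,
         ~ constant_on (simplex R k) (peval b),
         P0 = [set p | simplex R k p /\ peval b p <= 0] &
         PA = [set p | simplex R k p /\ 0 < peval b p]])).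
Proof.
have [p0 P0p0] : P0 !=set0 by apply/set0P/eqP.
have [pA PApA] : PA !=set0.
  apply: contrapT => PA0; apply: P0_neqT; apply/seteqP; split=> // p sp.
  by apply: contrapT => nPp; apply: PA0; exists p; rewrite PA_def.
have splitP p : simplex R k p -> P0 p \/ PA p.
  by move=> sp; have [?|?] := pselect (P0 p); [left|right; rewrite PA_def].
have PAs p : PA p -> simplex R k p by rewrite PA_def => -[].
split; split.
- move=> [phi [ub nc]]; have [b bn bE] := poly_of_test phi.
  pose B := power phi @` P0.
  have B0 : B !=set0 by exists (power phi p0), p0.
  (* By unbiasedness each power on [PA] bounds the powers on [P0], so [sup B] lies between the two
     ranges. *)
  have ubA p : PA p -> ubound B (power phi p) by move=> Ap _ [q Pq <-]; exact: ub.
  have supB : has_sup B by split=> //; exists (power phi pA); exact: ubA.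
  exists (b - (sup B)%:MP); split.
  + exact: degree_le_subC.
  + move=> [c cE]; apply: nc; exists (c + sup B) => p sp.
    by rewrite -(cE p sp) peval_subC subrK bE.
  + move=> p Pp; split; first exact: P0_sub.
    by rewrite peval_subC bE subr_le0; apply: ub_le_sup; [exact: supB.2|exists p].
  + move=> p Pp; split; first exact: PAs.
    by rewrite peval_subC bE subr_ge0; apply: ge_sup => //; exact: ubA.
- move=> [b [bn nc b0 bA]]; have [phi [a [a_gt0 phiE]]] := test_of_poly b bn.
  exists phi; split.
  + move=> p q Pp Pq; have [sp bp] := b0 p Pp; have [sq bq] := bA q Pq.
    by rewrite !phiE // lerD2l ler_pM2l // (le_trans bp).
  (* The witness undoes the affine change: [1 / 2 + a * t = c] is solved for [t]. *)
  + move=> [c cE]; apply: nc; exists ((c - 1 / 2) / a) => p sp.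
    by rewrite -(cE p sp) phiE // addrC addKr mulrC mulKf ?gt_eqF.
- move=> [phi sub]; have [b bn bE] := poly_of_test phi.
  (* Strictness calls for a maximum attained at some [m] in [P0]: strict unbiasedness at [m] itself
     then makes the shifted polynomial positive on [PA]. *)
  have [m mP mmax] : exists2 m, P0 m & forall p, P0 p -> power phi p <= power phi m.
    have cphi : {within P0, continuous (power phi)}.
      apply: continuous_subspaceT; rewrite (_ : power phi = peval b).
        exact: continuous_peval.
      by apply/funext => p; rewrite bE.
    have [m /set_mem mP mmax] := compact_EVT_max (ex_intro _ p0 P0p0)
      (closed_simplex_compact P0 P0_sub P0_closed) cphi.
    by exists m => // p Pp; apply/mmax/mem_set.
  have b0 p : P0 p -> peval (b - (power phi m)%:MP) p <= 0.
    by move=> Pp; rewrite peval_subC bE subr_le0; exact: mmax.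
  have bA p : PA p -> 0 < peval (b - (power phi m)%:MP) p.
    by move=> Pp; rewrite peval_subC bE subr_gt0; exact: sub.
  exists (b - (power phi m)%:MP); split.
  + exact: degree_le_subC.
  (* A constant could not be both nonpositive at [p0] and positive at [pA]. *)
  + move=> [c cE]; have := le_lt_trans (b0 _ P0p0) (bA _ PApA).
    by rewrite (cE _ (P0_sub _ P0p0)) (cE _ (PAs _ PApA)) ltxx.
  (* For the reverse inclusion, a point of the simplex outside [P0] lies in [PA], where the sign is
     the opposite one. *)
  + apply/seteqP; split=> p /=; first by move=> Pp; split; [exact: P0_sub|exact: b0].
    by move=> [sp bp]; have [//|/bA] := splitP p sp; rewrite ltNge bp.
  + apply/seteqP; split=> p /=; first by move=> Pp; split; [exact: PAs|exact: bA].
    by move=> [sp bp]; have [/b0|//] := splitP p sp; rewrite leNgt bp.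
- move=> [b [bn nc b0 bA]]; have [phi [a [a_gt0 phiE]]] := test_of_poly b bn.
  exists phi => p q; rewrite b0 bA => -[sp bp] [sq bq].
  by rewrite !phiE // ltrD2l ltr_pM2l // (le_lt_trans bp).
Qed.
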